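(* A perfect cuboid exists if and only if there exist rational numbers $\alpha_2,\beta_2,\gamma_2\in\mathbb{Q}\setminus\{0,1,-1\}$ satisfying $$\Big(\frac{2\gamma_2}{1-\gamma_2^2}\Big)^2+\Big(\frac{2\beta_2}{1-\beta_2^2}\Big)^2=\Big(\frac{2\alpha_2}{1-\alpha_2^2}\Big)^2.$$
   Context: A perfect cuboid is a triple of positive rational numbers $a,b,c$ such that $a^2+b^2$, $b^2+c^2$, $a^2+c^2$ and $a^2+b^2+c^2$ are all squares of rational numbers. *)

(* Defs.v *)
From mathcomp Require Import all_boot all_order all_algebra.

Set Implicit Arguments.
Unset Strict Implicit.
Unset Printing Implicit Defensive.

Import Order.TTheory GRing.Theory Num.Theory.
Local Open Scope ring_scope.

Definition is_rat_square (x : rat) : Prop := exists r : rat, x = r ^+ 2.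

Definition perfect_cuboid (a b c : rat) : Prop :=
  [/\ 0 < a, 0 < b & 0 < c] /\
  [/\ is_rat_square (a ^+ 2 + b ^+ 2),
      is_rat_square (b ^+ 2 + c ^+ 2),
      is_rat_square (a ^+ 2 + c ^+ 2) &
      is_rat_square (a ^+ 2 + b ^+ 2 + c ^+ 2)].

(* Main.v *)
Require Import Defs.
From mathcomp Require Import all_boot all_order all_algebra.
From mathcomp Require Import ring.

Set Implicit Arguments.
Unset Strict Implicit.
Unset Printing Implicit Defensive.

Import Order.TTheory GRing.Theory Num.Theory.
Local Open Scope ring_scope.

(** Scale a cuboid so that one edge is 1.  The face and space diagonal
    conditions then say that the other two edges x, y and the diagonal z of
    their face satisfy x^2 + y^2 = z^2, and that each of x, y, z is a leg of a
    right triangle with other leg 1 and rational hypotenuse.  Such legs are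
    parametrized by projecting the hyperbola r^2 - x^2 = 1 from the point
    (x, r) = (0, 1): they are the numbers x = 2t / (1 - t^2) with t outside
    {0, 1, -1}. *)

Section UnitLegs.
Variable F : fieldType.
Implicit Types t x r : F.

Definition unit_leg x : Prop := x != 0 /\ exists r, 1 + x ^+ 2 = r ^+ 2.

(* The double-angle formula: [tan2 (tan u) = tan (2 u)]. *)
Definition tan2 t : F := 2%:R * t / (1 - t ^+ 2).

Lemma notin_01N1 t :
  (t \notin [:: 0; 1; -1]) = (t != 0) && (1 - t ^+ 2 != 0).
Proof.
rewrite !inE !negb_or; congr (_ && _).
by rewrite -negb_or -eqf_sqr expr1n subr_eq0 [1 == _]eq_sym.
Qed.

Hypothesis two_neq0 : 2%:R != 0 :> F.

Lemma unit_leg_tan2 t : t \notin [:: 0; 1; -1] -> unit_leg (tan2 t).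
Proof.
rewrite notin_01N1 => /andP[t_neq0 den_neq0]; split.
  by rewrite !mulf_neq0 ?invr_eq0.
by exists ((1 + t ^+ 2) / (1 - t ^+ 2)); rewrite /tan2; field.
Qed.

Lemma unit_leg_tan2_surj x :
  unit_leg x -> exists2 t, t \notin [:: 0; 1; -1] & x = tan2 t.
Proof.
case=> x_neq0 [r hypE].
have legE : x ^+ 2 = (r - 1) * (r + 1).
  by rewrite -[x ^+ 2](addKr 1) hypE; ring.
have r1_neq0 : r - 1 != 0.
  have : x ^+ 2 != 0 by rewrite sqrf_eq0.
  by rewrite legE mulf_eq0 negb_or => /andP[].
have denE : 1 - ((r - 1) / x) ^+ 2 = 2%:R * (r - 1) / x ^+ 2.
  have -> : 2%:R * (r - 1) = x ^+ 2 - (r - 1) ^+ 2 by rewrite legE; ring.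
  by field.
exists ((r - 1) / x).
  by rewrite notin_01N1 denE !mulf_neq0 ?invr_eq0 ?sqrf_eq0.
by rewrite /tan2 denE; field; rewrite two_neq0 x_neq0 r1_neq0.
Qed.

End UnitLegs.

Section CuboidScaling.
Implicit Types a b c k x y z : rat.

Lemma is_rat_square_mul_sqr k x :
  is_rat_square x -> is_rat_square (k ^+ 2 * x).
Proof. by case=> r ->; exists (k * r); rewrite exprMn. Qed.

Lemma perfect_cuboidZ k a b c : 0 < k ->
  perfect_cuboid a b c -> perfect_cuboid (k * a) (k * b) (k * c).
Proof.
move=> k_gt0 [[a_gt0 b_gt0 c_gt0] [ab bc ac abc]].
split; first by rewrite !mulr_gt0.
by rewrite !exprMn -!mulrDr; split; apply: is_rat_square_mul_sqr.
Qed.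

Lemma perfect_cuboid_unit_edge a b c :
  perfect_cuboid a b c -> perfect_cuboid (a / c) (b / c) 1.
Proof.
move=> cuboid; have [[_ _ c_gt0] _] := cuboid.
rewrite -(mulVf (lt0r_neq0 c_gt0)) ![_ / c]mulrC.
by apply: perfect_cuboidZ; rewrite ?invr_gt0.
Qed.

Lemma perfect_cuboid_unit_legs a b : perfect_cuboid a b 1 ->
  exists z, [/\ unit_leg a, unit_leg b, unit_leg z & a ^+ 2 + b ^+ 2 = z ^+ 2].
Proof.
case=> [[a_gt0 b_gt0 _]]; rewrite expr1n ![_ + 1]addrC.
move=> [[z zE] leg_b leg_a leg_z]; exists z; rewrite zE in leg_z.
have z_neq0 : z != 0.
  by rewrite -sqrf_eq0 -zE lt0r_neq0 // addr_gt0 ?exprn_gt0.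
by split=> //; split=> //; apply: lt0r_neq0.
Qed.

Lemma unit_legs_perfect_cuboid x y z :
  unit_leg x -> unit_leg y -> unit_leg z -> x ^+ 2 + y ^+ 2 = z ^+ 2 ->
  perfect_cuboid `|x| `|y| 1.
Proof.
move=> [x_neq0 leg_x] [y_neq0 leg_y] [_ leg_z] zE.
split; first by rewrite !normr_gt0.
rewrite !real_normK ?num_real // expr1n ![_ + 1]addrC zE.
by split=> //; exists z.
Qed.

Lemma exists_perfect_cuboidP :
  (exists a b c, perfect_cuboid a b c) <->
  (exists x y z, [/\ unit_leg x, unit_leg y, unit_leg z &
                     x ^+ 2 + y ^+ 2 = z ^+ 2]).
Proof.
split.
  move=> [a [b [c /perfect_cuboid_unit_edge/perfect_cuboid_unit_legs[z legs]]]].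
  by exists (a / c), (b / c), z.
move=> [x [y [z [leg_x leg_y leg_z zE]]]].
by exists `|x|, `|y|, 1; apply: unit_legs_perfect_cuboid zE.
Qed.

End CuboidScaling.

Theorem theorem2 :
  (exists a b c : rat, perfect_cuboid a b c) <->
  (exists alpha2 beta2 gamma2 : rat,
     [/\ alpha2 \notin [:: 0; 1; -1],
         beta2 \notin [:: 0; 1; -1],
         gamma2 \notin [:: 0; 1; -1] &
         (2%:R * gamma2 / (1 - gamma2 ^+ 2)) ^+ 2 +
         (2%:R * beta2 / (1 - beta2 ^+ 2)) ^+ 2 =
         (2%:R * alpha2 / (1 - alpha2 ^+ 2)) ^+ 2]).
Proof.
have tan2_onto := @unit_leg_tan2_surj rat isT.
rewrite exists_perfect_cuboidP; split.
  move=> [x [y [z []]]] /tan2_onto[gamma gammaN ->] /tan2_onto[beta betaN ->].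
  by move=> /tan2_onto[alpha alphaN ->] sum_sqr; exists alpha, beta, gamma.
move=> [alpha [beta [gamma [alphaN betaN gammaN sum_sqr]]]].
exists (tan2 gamma), (tan2 beta), (tan2 alpha).
by split=> //; apply: unit_leg_tan2.
Qed.
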